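(* Let $q>2$, $k\mid n$, and let $\mathcal S$ be a set of $q^k+1$ elements of $\mathcal D$. The following are equivalent: (1) $\mathcal S=\phi(m)$ for some $\mathbb{F}_{q^k}$-subline $m$ contained in $l_\infty$; (2) for any three elements of $\mathcal S$, the unique regulus containing them is contained in $\mathcal S$; (3) there is a $(2k-1)$-dimensional subspace of $H_\infty$ meeting each element of $\mathcal S$ in a $(k-1)$-dimensional subspace; (4) there is a $(2k-1)$-dimensional subspace of $H_\infty$ meeting each element of $\mathcal S$ in a $(k-1)$-dimensional subspace belonging to $\mathcal D_k$.
   Context: Let $q$ be a prime power and $n\ge1$. Points of $\mathrm{PG}(2,q^n)$ are written $(a,b,c)_{\mathbb{F}_{q^n}}$; $l_\infty$ is the line $c=0$. An $\mathbb{F}_{q^k}$-subline ($k\mid n$) is a set $\{(su+tv)_{\mathbb{F}_{q^n}}:(s,t)\in\mathbb{F}_{q^k}^2\setminus\{(0,0)\}\}$ for $\mathbb{F}_{q^n}$-independent $u,v\in\mathbb{F}_{q^n}^3$. Let $H_\infty=\mathrm{PG}(2n-1,q)$ be the projective space of the $\mathbb{F}_q$-vector space $\mathbb{F}_{q^n}^2$, points $(a,b,0)_{\mathbb{F}_q}$. For $k\mid n$, $\mathcal D_k=\{\{(ax,bx,0)_{\mathbb{F}_q}:x\in\mathbb{F}_{q^k}^*\}:(a,b)\in\mathbb{F}_{q^n}^2\setminus\{(0,0)\}\}$ and $\mathcal D=\mathcal D_n$ (a Desarguesian $(n-1)$-spread). The map $\phi$ sends a point $(a,b,0)_{\mathbb{F}_{q^n}}$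 of $l_\infty$ to $\{(ax,bx,0)_{\mathbb{F}_q}:x\in\mathbb{F}_{q^n}^*\}\in\mathcal D$. A regulus is a set $\mathcal R$ of $(n-1)$-spaces in a $(2n-1)$-space such that every line meeting three elements of $\mathcal R$ meets all elements of $\mathcal R$; any three pairwise disjoint $(n-1)$-spaces spanning a $(2n-1)$-space lie in a unique regulus of $q+1$ elements. *)

(* Defs.v *)
From HB Require Import structures.
From mathcomp Require Import all_boot all_order all_algebra all_field.
Set Implicit Arguments. Unset Strict Implicit. Unset Printing Implicit Defensive.
Import GRing.Theory.
Local Open Scope ring_scope.

(* Setting: F = F_q (a finite field), L = F_{q^n} a field extension of F of
   dimension n, K = F_{q^k} a subfield of L of dimension k over F.
   The F-vector space L * L (= F_{q^n}^2 over F_q) is the underlying vector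
   space of H_oo = PG(2n-1,q); projective d-subspaces of H_oo are the
   F-subspaces of L * L of (vector) dimension d+1. *)

Section Defs.
Variables (F : finFieldType) (L : fieldExtType F).

Definition spr (U : {vspace L}) (a b : L) : {vspace (L * L)%type} :=
  (linfun (fun x : L => (a * x, b * x)) @: U)%VS.

Definition inD (X : {vspace (L * L)%type}) : Prop :=
  exists a b : L, (a, b) != (0, 0) /\ X = spr fullv a b.

Definition inDk (K : {subfield L}) (X : {vspace (L * L)%type}) : Prop :=
  exists a b : L, (a, b) != (0, 0) /\ X = spr K a b.

(* phi : point (a,b,0)_{F_{q^n}} of l_oo |-> element of D.
   Points of PG(2,q^n) are given by nonzero row vectors of L^3. *)
Definition phi (x : 'rV[L]_3) : {vspace (L * L)%type} := spr fullv (x 0 0) (x 0 1).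

Definition regulus (R : seq {vspace (L * L)%type}) : Prop :=
  [/\ uniq R, size R = #|F|.+1,
      (forall X, X \in R -> \dim X = \dim {:L}) &
      forall l : {vspace (L * L)%type}, \dim l = 2%N ->
        (forall A B C, A \in R -> B \in R -> C \in R ->
           A != B -> A != C -> B != C ->
           (l :&: A != 0)%VS -> (l :&: B != 0)%VS -> (l :&: C != 0)%VS ->
           forall X, X \in R -> (l :&: X != 0)%VS)].

Definition is_phi_of_subline_in_linf (K : {subfield L})
    (S : seq {vspace (L * L)%type}) : Prop :=
  exists u v : 'rV[L]_3,
    [/\ (forall lam mu : L, lam *: u + mu *: v = 0 -> lam = 0 /\ mu = 0),
        (forall s t : L, s \in K -> t \in K -> (s, t) != (0, 0) ->
           (s *: u + t *: v) 0 2 = 0) &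
        (forall X, X \in S <->
           exists s t : L, [/\ s \in K, t \in K, (s, t) != (0, 0) &
                               X = phi (s *: u + t *: v)])].
End Defs.

(* Main.v *)
(* Members of D are the L-lines of L^2, i.e. the points of PG(1, L), and the regulus
   through three of them is the F-subline they span: counting vectors shows that
   every vector of a regulus member lies, up to scalars, on exactly one transversal.
   If S is closed under F-sublines, normalise it to contain oo, 0 and 1. As q > 2,
   the remaining points form an F-subspace of L closed under inversion; by Hua's
   identity x - (x^-1 + (y^-1 - x)^-1)^-1 = x^2 y it is a subfield, and it has the
   size of K, so it is K.
   If W meets every member of S in dimension k, the intersections partition the nonzero
   vectors of W; given three members of S, W contains an F-line meeting them, and the
   points of this line give the F-subline through the three. *)

Require Import Defs.
From HB Require Import structures.
From mathcomp Require Import all_boot all_order all_algebra all_field.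
From mathcomp Require Import zify ring.
Import GRing.Theory.
Local Open Scope ring_scope.
Set Implicit Arguments. Unset Strict Implicit. Unset Printing Implicit Defensive.

(** * Enumeration and counting in subspaces over a finite field *)

(** The enumeration passes through [finvect_type vT], which carries the finite structure, while the
    result stays a list over [vT]. *)
Definition vseq (F : finFieldType) (vT : vectType F) (V : {vspace vT}) : seq vT :=
  enum (fun x : finvect_type vT => (x : vT) \in V).

Lemma vseq_uniq (F : finFieldType) (vT : vectType F) (V : {vspace vT}) :
  uniq (vseq V).
Proof. exact: enum_uniq. Qed.

Lemma mem_vseq (F : finFieldType) (vT : vectType F) (V : {vspace vT}) x :
  (x \in vseq V) = (x \in V).
Proof. exact: (mem_enum (fun x : finvect_type vT => (x : vT) \in V) x). Qed.

Lemma size_vseq (F : finFieldType) (vT : vectType F) (V : {vspace vT}) :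
  size (vseq V) = (#|F| ^ \dim V)%N.
Proof.
case: F vT V => F cF [T cT] V; apply: etrans (esym (cardE _)) _.
exact: (@card_vspace _ (finvect_type (Vector.Pack cT)) cT V).
Qed.


(** The elements of [T] can be listed, and closure under linear combinations makes their span no
    larger than [T]. *)
Lemma pred_vspace (F : finFieldType) (vT : vectType F) (T : {pred vT}) : 0 \in T ->
  {in T &, forall x y, x + y \in T} -> (forall c : F, {in T, forall x, c *: x \in T}) ->
  exists U : {vspace vT}, U =i T.
Proof.
move=> T0 TD TZ; pose X := filter T (vseq {:vT}).
exists <<X>>%VS => x; apply/idP/idP => [xX|xT].
  rewrite (coord_span (X := in_tuple X) xX).
  apply: (big_ind (fun y => y \in T)) => // i _; apply: TZ.
  by have := mem_nth 0 (ltn_ord i); rewrite mem_filter => /andP[].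
by apply: memv_span; rewrite mem_filter mem_vseq memvf andbT.
Qed.

(** * Vectors of [L * L], determinants, and members of [D] as points of PG(1, L) *)

Section Points.
Variables (F : finFieldType) (L : fieldExtType F).
Implicit Types (U V W X : {vspace (L * L)%type}) (a b v w : (L * L)%type).
Implicit Types (x y z s t : L) (E : {subfield L}).
Implicit Types (S : seq {vspace (L * L)%type}).

(** Scaling by [L]: the vector space structure of [L * L] has its scalars in [F]. The order of the
    factors matches [spr]. *)
Definition sc z w : (L * L)%type := (w.1 * z, w.2 * z).
Definition lc s a t b : (L * L)%type := (s * a.1 + t * b.1, s * a.2 + t * b.2).
Definition det2 a b : L := a.1 * b.2 - a.2 * b.1.
Definition pt w : {vspace (L * L)%type} := spr fullv w.1 w.2.

Lemma sc_is_linear w : linear (sc^~ w).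
Proof. by move=> c x y; congr (_, _); rewrite /= mulrDr scalerAr. Qed.

(** Packaged as a linear map so that the [linfun] inside [spr] can be evaluated. *)
Definition sc_linear w : {linear L -> (L * L)%type} :=
  HB.pack (sc^~ w) (GRing.isLinear.Build _ _ _ _ (sc^~ w) (sc_is_linear w)).

Lemma mem_spr (U : {vspace L}) w v :
  reflect (exists2 x, x \in U & v = sc x w) (v \in spr U w.1 w.2).
Proof.
have gE x : linfun (fun x : L => (w.1 * x, w.2 * x)) x = sc x w.
  exact: (lfunE (sc_linear w)).
by apply: (iffP memv_imgP) => -[x xU ->]; exists x; rewrite ?gE.
Qed.

Lemma mem_pt w v : reflect (exists x, v = sc x w) (v \in pt w).
Proof.
by apply: (iffP (mem_spr _ _ _)) => [[x _ ->]|[x ->]]; exists x; rewrite ?memvf.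
Qed.

Lemma sc_eq0 z w : (sc z w == 0) = (z == 0) || (w == 0).
Proof.
case: w => w1 w2; rewrite /sc !xpair_eqE /= !mulf_eq0.
by case: (z == 0); rewrite ?orbT ?orbF.
Qed.

Lemma scA x y w : sc x (sc y w) = sc (y * x) w.
Proof. by rewrite /sc /= !mulrA. Qed.

Lemma sc1 w : sc 1 w = w.
Proof. by case: w => w1 w2; rewrite /sc /= !mulr1. Qed.

Lemma dim_spr (U : {vspace L}) w : w != 0 -> \dim (spr U w.1 w.2) = \dim U.
Proof.
move=> w0; apply: limg_dim_eq; apply/eqP; rewrite -subv0; apply/subvP => x.
rewrite memv_cap memv0 => /andP[_]; rewrite memv_ker.
rewrite (lfunE (sc_linear w)) /=.
by rewrite sc_eq0 (negPf w0) orbF.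
Qed.

Lemma dim_pt w : w != 0 -> \dim (pt w) = \dim {:L}.
Proof. exact: dim_spr. Qed.

Lemma pt_id w : w \in pt w.
Proof. by apply/mem_pt; exists 1; rewrite sc1. Qed.

Lemma pt_sc z w : z != 0 -> pt (sc z w) = pt w.
Proof.
move=> z0; apply/vspaceP=> v; apply/mem_pt/mem_pt=> -[x ->].
  by rewrite scA; eexists.
by exists (x / z); rewrite scA mulrC divfK.
Qed.

Lemma pt_mem w v : v \in pt w -> v != 0 -> pt v = pt w.
Proof. by case/mem_pt=> x -> /[!sc_eq0] /norP[x0 _]; rewrite pt_sc. Qed.

Lemma inD_pt X : inD X -> exists2 w, w != 0 & X = pt w.
Proof. by case=> a [b [ab0 ->]]; exists (a, b). Qed.

Lemma inD_mem X w : inD X -> w \in X -> w != 0 -> X = pt w.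
Proof. by case/inD_pt=> v v0 -> /pt_mem h /h. Qed.

Lemma det2_sc x a y b : det2 (sc x a) (sc y b) = x * y * det2 a b.
Proof. by rewrite /det2 /sc /=; ring. Qed.

Lemma det2_lc s a t b s' t' :
  det2 (lc s a t b) (lc s' a t' b) = (s * t' - t * s') * det2 a b.
Proof. by rewrite /det2 /lc /=; ring. Qed.

Lemma det2_lcl s a t b : det2 (lc s a t b) b = s * det2 a b.
Proof. by rewrite /det2 /lc /=; ring. Qed.

Lemma det2_lcr s a t b : det2 a (lc s a t b) = t * det2 a b.
Proof. by rewrite /det2 /lc /=; ring. Qed.

Lemma det2_neq0 a b : det2 a b != 0 -> (a != 0) * (b != 0).
Proof.
by move=> d; split; apply: contraNneq d => ->; rewrite /det2 /=; apply/eqP; ring.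
Qed.

Lemma det2_pt_eq0 a b : a != 0 -> b != 0 -> det2 a b = 0 -> pt a = pt b.
Proof.
move=> a0 b0 /subr0_eq d; apply: pt_mem a0; apply/mem_pt.
have [b10|b10] := eqVneq b.1 0.
  have b20 : b.2 != 0.
    by apply: contraNneq b0; case: b b10 {d} => ? ? /= -> ->.
  exists (a.2 / b.2); rewrite [LHS]surjective_pairing; congr (_, _).
    apply/eqP; rewrite b10 mul0r; move/eqP: d.
    by rewrite b10 mulr0 mulf_eq0 (negPf b20) orbF.
  by rewrite mulrC divfK.
exists (a.1 / b.1); rewrite [LHS]surjective_pairing; congr (_, _).
  by rewrite mulrC divfK.
by rewrite mulrA [b.2 * _]mulrC d mulfK.
Qed.

Lemma pt_neq_det2 a b : a != 0 -> b != 0 -> pt a != pt b -> det2 a b != 0.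
Proof. by move=> a0 b0; apply: contraNneq => /det2_pt_eq0 ->. Qed.

Lemma det2_pt_neq a b : det2 a b != 0 -> pt a != pt b.
Proof.
apply: contraNneq => e; have /mem_pt[x ->] : a \in pt b by rewrite -e pt_id.
by rewrite /det2 /=; apply/eqP; ring.
Qed.

(** Cramer's rule. *)
Lemma lc_basis a b w : det2 a b != 0 ->
  w = lc (det2 w b / det2 a b) a (det2 a w / det2 a b) b.
Proof.
move=> d; rewrite [LHS]surjective_pairing /lc; move: d; rewrite /det2 => d.
by congr (_, _); field.
Qed.

Lemma lc_eq0 s a t b : det2 a b != 0 -> (lc s a t b == 0) = ((s, t) == (0, 0)).
Proof.
move=> d; apply/eqP/eqP => [e|[-> ->]].
  have := det2_lc s a t b 0 1; have := det2_lc s a t b 1 0.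
  rewrite e [det2 0 _]/det2 [det2 0 _]/det2 !mul0r subrr !mulr0 !mulr1 sub0r subr0.
  move/esym/eqP; rewrite mulf_eq0 (negPf d) orbF oppr_eq0 => /eqP ->.
  by move/esym/eqP; rewrite mulf_eq0 (negPf d) orbF => /eqP ->.
by rewrite /lc !mul0r addr0.
Qed.

(** Write a generator of [C] by Cramer's rule as a combination of generators of [A] and [B]. Both
    coefficients are nonzero because [C] differs from [A] and [B], so they can be absorbed into the
    generators. *)
Lemma inD_frame A B C : inD A -> inD B -> inD C ->
  A != B -> A != C -> B != C ->
  exists a b, [/\ det2 a b != 0, A = pt a, B = pt b & C = pt (lc 1 a 1 b)].
Proof.
move=> /inD_pt[a a0 ->] /inD_pt[b b0 ->] /inD_pt[c c0 ->].
move=> /(pt_neq_det2 a0 b0) ab /(pt_neq_det2 a0 c0) ac.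
move=> /(pt_neq_det2 b0 c0) bc.
have cb : det2 c b != 0 by rewrite -oppr_eq0 /det2 opprB [X in X - _]mulrC [X in _ - X]mulrC.
have x0 : det2 c b / det2 a b != 0 by rewrite mulf_neq0 ?invr_eq0.
have y0 : det2 a c / det2 a b != 0 by rewrite mulf_neq0 ?invr_eq0.
exists (sc (det2 c b / det2 a b) a), (sc (det2 a c / det2 a b) b).
rewrite !pt_sc // det2_sc !mulf_neq0 ?invr_eq0 //; split=> //; congr pt.
by rewrite {1}(lc_basis c ab) /lc /sc /=; congr (_, _); ring.
Qed.


(** * Sublines over a subfield [E], as predicates and as lists *)

Definition subline E a b X : Prop :=
  exists s t, [/\ s \in E, t \in E, (s, t) != (0, 0) & X = pt (lc s a t b)].

(** One representative for each point of PG(1, E), so that sublines can be counted without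
    repetition. *)
Definition dirs E : seq (L * L)%type :=
  (0, 1) :: [seq (1, t) | t <- vseq E].

Lemma mem_dirs E d : d \in dirs E -> [/\ d.1 \in E, d.2 \in E & d != (0, 0)].
Proof.
rewrite inE => /predU1P[->|/mapP[t + ->]].
  by rewrite mem0v mem1v xpair_eqE oner_eq0 andbF.
by rewrite mem_vseq => tE; rewrite mem1v tE xpair_eqE oner_eq0.
Qed.

Lemma dirs_normal E s t : s \in E -> t \in E -> (s, t) != (0, 0) ->
  exists d z, [/\ d \in dirs E, z \in E, z != 0, s = z * d.1 & t = z * d.2].
Proof.
move=> sE tE; have [->|s0] := eqVneq s 0 => st0.
  exists (0, 1), t; rewrite mem_head mulr0 mulr1; split=> //.
  by apply: contraNneq st0 => ->.
exists (1, t / s), s; split; rewrite ?mulr1 //; last by rewrite mulrC divfK.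
by rewrite inE map_f ?orbT // mem_vseq rpred_div.
Qed.

Lemma dirs_det2 E d d' : d \in dirs E -> d' \in dirs E -> d != d' -> det2 d d' != 0.
Proof.
rewrite !inE /det2 => /predU1P[->|/mapP[t _ ->]] /predU1P[->|/mapP[t' _ ->]] /=.
- by rewrite eqxx.
- by rewrite mul0r mul1r sub0r oppr_eq0 oner_eq0.
- by rewrite mulr0 mul1r subr0 oner_eq0.
by rewrite mul1r mulr1 subr_eq0 xpair_eqE eqxx eq_sym.
Qed.

Lemma dirs_uniq E : uniq (dirs E).
Proof.
rewrite /= map_inj_uniq ?vseq_uniq ?andbT => [|x y []//].
by apply/mapP => -[t _ []] /esym/eqP; rewrite oner_eq0.
Qed.

Lemma size_dirs E : size (dirs E) = (#|F| ^ \dim E).+1.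
Proof. by rewrite /= size_map size_vseq. Qed.

Definition subline_seq E a b := [seq pt (lc d.1 a d.2 b) | d : (L * L)%type <- dirs E].

Lemma lc_sc z s a t b : lc (z * s) a (z * t) b = sc z (lc s a t b).
Proof. by congr (_, _) => /=; ring. Qed.

Lemma mem_subline_seq E a b X :
  reflect (subline E a b X) (X \in subline_seq E a b).
Proof.
apply: (iffP mapP) => [[d dE ->]|[s [t [sE tE st0 ->]]]].
  by have [? ? ?] := mem_dirs dE; exists d.1, d.2; rewrite -surjective_pairing.
have [d [z [dE _ z0 -> ->]]] := dirs_normal sE tE st0.
by exists d; rewrite // lc_sc pt_sc.
Qed.

Lemma det2_lc_dirs E a b d d' : det2 a b != 0 -> d \in dirs E -> d' \in dirs E ->
  d != d' -> det2 (lc d.1 a d.2 b) (lc d'.1 a d'.2 b) != 0.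
Proof. by move=> ab dE d'E dd'; rewrite det2_lc mulf_neq0 // (dirs_det2 dE d'E). Qed.

Lemma subline_seq_uniq E a b : det2 a b != 0 -> uniq (subline_seq E a b).
Proof.
move=> ab; rewrite map_inj_in_uniq ?dirs_uniq // => d d' dE d'E /eqP.
by apply: contraTeq => /(det2_lc_dirs ab dE d'E)/det2_pt_neq.
Qed.

(** * Intersections and lines over [F] *)

Lemma capv_neq0P U V :
  reflect (exists v, [/\ v != 0, v \in U & v \in V]) (U :&: V != 0)%VS.
Proof.
apply: (iffP idP) => [|[v [v0 vU vV]]].
  rewrite -vpick0 => v0; exists (vpick (U :&: V)); split=> //;
  by have := memv_pick (U :&: V); rewrite memv_cap => /andP[].
apply: contraNneq v0 => UV; rewrite -memv0 -UV memv_cap vU vV //.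
Qed.

Lemma sc_scale (c : F) w : sc c%:A w = c *: w.
Proof. by congr (_, _); rewrite /= mulrC -scalerAl mul1r. Qed.

Lemma memv_sc1 V s w : s \in 1%VS -> w \in V -> sc s w \in V.
Proof. by move=> /vlineP[c ->] wV; rewrite sc_scale memvZ. Qed.

Lemma dim_lineD v w : det2 v w != 0 -> \dim (<[v]> + <[w]>) = 2%N.
Proof.
move=> vw; have [v0 w0] := det2_neq0 vw.
rewrite dimv_disjoint_sum ?dim_vline ?v0 ?w0 //.
apply/eqP; rewrite -subv0; apply/subvP=> u.
rewrite memv_cap memv0 => /andP[/vlineP[c ->] /vlineP[c' e]].
(* If [c v = c' w], then pairing with [w] under [det2] kills the right-hand side. *)
have /eqP : c%:A * det2 v w = 0.
  rewrite -[c%:A]mulr1 -det2_sc sc1 sc_scale e -sc_scale /det2 /=; ring.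
by rewrite mulf_eq0 (negPf vw) orbF scaler_eq0 oner_eq0 orbF => /eqP ->; rewrite scale0r.
Qed.

Lemma line_lc (l : {vspace (L * L)%type}) v w u : \dim l = 2%N -> v \in l -> w \in l ->
  det2 v w != 0 -> u \in l -> exists s t, [/\ s \in 1%VS, t \in 1%VS & u = lc s v t w].
Proof.
move=> l2 vl wl vw; suff -> : l = (<[v]> + <[w]>)%VS.
  move=> /memv_addP[_ /vlineP[c ->] [_ /vlineP[c' ->] ->]].
  exists c%:A, c'%:A; rewrite !memvZ ?mem1v //; split=> //.
  by rewrite -!sc_scale; congr (_, _) => /=; rewrite [_%:A * _]mulrC [c'%:A * _]mulrC.
apply/esym/eqP; rewrite eqEdim l2 dim_lineD // andbT.
by rewrite subv_add -!memvE vl.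
Qed.

Lemma lc_mem V s v t w : s \in 1%VS -> t \in 1%VS -> v \in V -> w \in V ->
  lc s v t w \in V.
Proof.
move=> s1 t1 vV wV; have -> : lc s v t w = sc s v + sc t w.
  by congr (_, _) => /=; rewrite mulrC [t * _]mulrC.
by rewrite memvD ?memv_sc1.
Qed.

(** * Reguli through three members of [D] are [F]-sublines *)

Let F1 : {subfield L} := 1%AS.

(* A line meeting three members is [x *: <a, b>_F] for a single scalar [x : L],
   hence contains a nonzero vector of every member. *)
Lemma subline_regulus a b : det2 a b != 0 -> regulus (subline_seq F1 a b).
Proof.
move=> ab; split; first exact: subline_seq_uniq.
- by rewrite size_map size_dirs dimv1 expn1.
- move=> X /mem_subline_seq[s [t [_ _ st0 ->]]].
  by rewrite dim_pt ?lc_eq0.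
move=> l l2 A B C /mapP[d1 d1E ->] /mapP[d2 d2E ->] /mapP[d3 d3E ->].
move=> AB AC BC /capv_neq0P[v1 [v10 v1l v1A]] /capv_neq0P[v2 [v20 v2l v2B]].
move=> /capv_neq0P[v3 [v30 v3l v3C]] X /mapP[d dE ->].
have n12 : d1 != d2 by apply: contraNneq AB => ->.
have n13 : d1 != d3 by apply: contraNneq AC => ->.
have n23 : d2 != d3 by apply: contraNneq BC => ->.
have D12 := dirs_det2 d1E d2E n12; have D13 := dirs_det2 d1E d3E n13.
have D23 := dirs_det2 d2E d3E n23.
move: v1A v2B v3C => /mem_pt[x1 e1] /mem_pt[x2 e2] /mem_pt[x3 e3].
move: v10 v20 v30; rewrite e1 e2 e3 !sc_eq0 => /norP[x10 w10] /norP[x20 w20] /norP[x30 w30].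
have D := det2_lc_dirs ab d1E d2E n12.
have v12 : det2 v1 v2 != 0 by rewrite e1 e2 det2_sc !mulf_neq0.
have [s [t [s1 t1 ev3]]] := line_lc l2 v1l v2l v12 v3l.
have [d11 d12 _] := mem_dirs d1E; have [d21 d22 _] := mem_dirs d2E.
have [d31 d32 _] := mem_dirs d3E; have [dd1 dd2 d0] := mem_dirs dE.
(* Pair the two expressions of [v3] with the generators of directions [d2] and [d1]: this shows that
   [x1] and [x2] are [F]-multiples of [x3]. *)
have ea : det2 d3 d2 * x3 = s * x1 * det2 d1 d2.
  apply: (mulIf ab); transitivity (det2 v3 (lc d2.1 a d2.2 b)).
    by rewrite e3 /det2 /lc /sc /=; ring.
  by rewrite ev3 e1 e2 /det2 /lc /sc /=; ring.
have eb : det2 d1 d3 * x3 = t * x2 * det2 d1 d2.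
  apply: (mulIf ab); transitivity (det2 (lc d1.1 a d1.2 b) v3).
    by rewrite e3 /det2 /lc /sc /=; ring.
  by rewrite ev3 e1 e2 /det2 /lc /sc /=; ring.
have D32 : det2 d3 d2 != 0 by rewrite (dirs_det2 d3E d2E) // eq_sym.
have detE d' d'' : d' \in dirs F1 -> d'' \in dirs F1 -> det2 d' d'' \in F1.
  by move=> /mem_dirs[? ? _] /mem_dirs[? ? _]; rewrite rpredB ?rpredM.
have s0 : s != 0.
  by apply/eqP => s0; have /eqP := ea;
    rewrite s0 !mul0r mulf_eq0 (negPf D32) (negPf x30).
have t0 : t != 0.
  by apply/eqP => t0; have /eqP := eb;
    rewrite t0 !mul0r mulf_eq0 (negPf D13) (negPf x30).
apply/capv_neq0P; exists (sc x3 (lc d.1 a d.2 b)).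
rewrite sc_eq0 negb_or x30 lc_eq0 // -surjective_pairing d0; split=> //; last first.
  by apply/mem_pt; exists x3.
(* Expand [d] in [d1], [d2] by Cramer's rule and substitute for [x1] and [x2]; the coefficients on
   [v1], [v2] then lie in [F]. *)
have -> : sc x3 (lc d.1 a d.2 b) =
    lc (det2 d d2 * s / det2 d3 d2) v1 (det2 d1 d * t / det2 d1 d3) v2.
  have ex1 : x1 = det2 d3 d2 * x3 / (s * det2 d1 d2).
    by rewrite ea; field; rewrite s0 D12.
  have ex2 : x2 = det2 d1 d3 * x3 / (t * det2 d1 d2).
    by rewrite eb; field; rewrite t0 D12.
  have ed := lc_basis d D12.
  have ed1 : d.1 = det2 d d2 / det2 d1 d2 * d1.1 + det2 d1 d / det2 d1 d2 * d2.1.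
    exact: (congr1 fst ed).
  have ed2 : d.2 = det2 d d2 / det2 d1 d2 * d1.2 + det2 d1 d / det2 d1 d2 * d2.2.
    exact: (congr1 snd ed).
  rewrite ed1 ed2 e1 e2 ex1 ex2 /lc /sc.
  by congr (_, _) => /=; field; rewrite D12 D32 D13 s0 t0.
by apply: lc_mem => //; rewrite rpred_div ?rpredM ?detE.
Qed.

(** For each nonzero [z], the line [z <a, b>_F] meets three known members, hence [X], which singles
    out a direction [g z] over [F]. Counting shows that these meeting points exhaust [X], and
    additivity of [X] then forces [g] to be constant. *)
Lemma regulus_subline R a b X : regulus R -> det2 a b != 0 ->
  pt a \in R -> pt b \in R -> pt (lc 1 a 1 b) \in R -> X \in R -> subline F1 a b X.
Proof.
case=> _ _ dimR linesR ab aR bR cR XR; pose e (d : (L * L)%type) := lc d.1 a d.2 b.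
have e_neq0 d : d \in dirs F1 -> e d != 0.
  by case/mem_dirs => _ _ d0; rewrite lc_eq0 // -surjective_pairing.
have eI z d z' d' : z != 0 -> z' != 0 -> d \in dirs F1 -> d' \in dirs F1 ->
    sc z (e d) = sc z' (e d') -> z = z' /\ d = d'.
  move=> z0 z'0 dE d'E eq_e; have [dd'|n] := eqVneq d d'.
    split=> //; apply/eqP; rewrite -subr_eq0; rewrite -dd' in eq_e.
    have : sc (z - z') (e d) == 0.
      have -> : sc (z - z') (e d) = sc z (e d) - sc z' (e d).
        by congr (_, _) => /=; ring.
      by rewrite eq_e subrr.
    by rewrite sc_eq0 (negPf (e_neq0 _ dE)) orbF.
  have : det2 (sc z (e d)) (sc z' (e d')) != 0.
    by rewrite det2_sc !mulf_neq0 // (det2_lc_dirs (E := F1)).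
  by rewrite eq_e /det2 mulrC subrr eqxx.
have ptsX z : z != 0 -> has (fun d => sc z (e d) \in X) (dirs F1).
  move=> z0; set l := (<[sc z a]> + <[sc z b]>)%VS.
  have zab : det2 (sc z a) (sc z b) != 0 by rewrite det2_sc !mulf_neq0.
  have [[za0 zb0] l2] := (det2_neq0 zab, dim_lineD zab).
  have zal : sc z a \in l by rewrite memvE addvSl.
  have zbl : sc z b \in l by rewrite memvE addvSr.
  have abn := det2_pt_neq ab.
  have acn : pt a != pt (lc 1 a 1 b).
    by rewrite det2_pt_neq // det2_lcr mul1r.
  have bcn : pt b != pt (lc 1 a 1 b).
    by rewrite eq_sym det2_pt_neq // det2_lcl mul1r.
  have meet U u : U \in R -> u != 0 -> u \in l -> u \in U -> (l :&: U != 0)%VS.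
    by move=> _ u0 ul uw; apply/capv_neq0P; exists u.
  have zabl : lc 1 (sc z a) 1 (sc z b) \in l by rewrite lc_mem ?mem1v.
  have /capv_neq0P[v [v0 vl vX]] : (l :&: X != 0)%VS.
    apply: (linesR l l2 _ _ _ aR bR cR abn acn bcn) => //.
    - by apply: meet za0 zal _ => //; apply/mem_pt; exists z.
    - by apply: meet zb0 zbl _ => //; apply/mem_pt; exists z.
    apply: meet zabl _ => //; rewrite ?lc_eq0 ?xpair_eqE ?oner_eq0 //.
    by apply/mem_pt; exists z; congr (_, _) => /=; ring.
  have [s [t [s1 t1 ev]]] := line_lc l2 zal zbl zab vl.
  have st0 : (s, t) != (0, 0) by rewrite -(lc_eq0 s t zab) -ev.
  have [d [c [dE cE c0 es et]]] := dirs_normal (E := F1) s1 t1 st0.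
  apply/hasP; exists d => //.
  have -> : sc z (e d) = sc c^-1 v.
    by rewrite ev es et lc_sc scA mulfV // sc1; congr (_, _) => /=; ring.
  by rewrite memv_sc1 // (rpredV F1).
(* The default [(0, 0)] is never reached for nonzero [z], since [ptsX] makes the search succeed. *)
pose g z := nth (0, 0) (dirs F1) (find (fun d => sc z (e d) \in X) (dirs F1)).
have gE z : z != 0 -> g z \in dirs F1.
  by move=> /ptsX; rewrite has_find => /(mem_nth (0, 0)).
have gX z : z != 0 -> sc z (e (g z)) \in X by move=> /ptsX /(nth_find (0, 0)).
pose h z := sc z (e (g z)).
have h_uniq : uniq [seq h z | z <- rem 0 (vseq fullv)].
  rewrite map_inj_in_uniq ?rem_uniq ?vseq_uniq // => z z'.
  rewrite !mem_rem_uniq ?vseq_uniq // !inE => /andP[z0 _] /andP[z'0 _].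
  by move=> /eI[] //; exact: gE.
(* [h] is injective from the nonzero scalars of [L] to the nonzero vectors of [X];
   [\dim X = \dim {:L}] makes these sets equinumerous, so [h] is onto. *)
have hX v : v \in X -> v != 0 -> exists2 z, z != 0 & v = h z.
  move=> vX v0; have [||_ eqX] := uniq_min_size h_uniq (s2 := rem 0 (vseq X)).
  - move=> w /mapP[z]; rewrite !mem_rem_uniq ?vseq_uniq // !inE => /andP[z0 _] ->.
    by rewrite sc_eq0 negb_or z0 e_neq0 ?gE // mem_vseq gX.
  - by rewrite size_map !size_rem ?mem_vseq ?mem0v // !size_vseq dimR.
  have : v \in rem 0 (vseq X).
    by rewrite mem_rem_uniq ?vseq_uniq // !inE v0 mem_vseq.
  rewrite -eqX => /mapP[z]; rewrite mem_rem_uniq ?vseq_uniq // !inE.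
  by move=> /andP[z0 _] ->; exists z.
have g_dir z d : z != 0 -> d \in dirs F1 -> sc z (e d) \in X -> d = g z.
  move=> z0 dE zdX; have [|z' z'0] := hX _ zdX; first by rewrite sc_eq0 negb_or z0 e_neq0.
  by move=> /eI[] //; [exact: gE | move=> ->].
have [n0 g1E] : (1 : L) != 0 /\ g 1 \in dirs F1 by rewrite gE oner_neq0.
suff gc z : z != 0 -> g z = g 1.
  have [s1 t1 d0] := mem_dirs g1E.
  exists (g 1).1, (g 1).2; rewrite -surjective_pairing; split=> //.
  apply/eqP; rewrite eqEdim dim_pt ?e_neq0 // dimR // leqnn andbT.
  apply/subvP => v vX; have [->|v0] := eqVneq v 0; first exact: mem0v.
  by have [z z0 ->] := hX v vX v0; rewrite /h gc //; apply/mem_pt; exists z.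
move=> z0; apply/eqP; apply/negP => /negP n.
have D : det2 (e (g 1)) (h z) != 0.
  by rewrite -[e _]sc1 det2_sc !mulf_neq0 // (det2_lc_dirs (E := F1)) ?gE // eq_sym.
(* If [g z] differs from [g 1], the sum [h 1 + h z] is a nonzero vector of [X], hence some [h z2].
   Determinants against the generators of directions [g z] and [g 1] give [D1] and [D2]. *)
have [||z2 z20 ez2] := hX (h 1 + h z).
- by rewrite memvD ?gX.
- apply: contraNneq D => hh; have -> : h z = - e (g 1).
    by rewrite -[e _]sc1 -[RHS]addr0 -hh addrA addNr add0r.
  by rewrite /det2 /=; apply/eqP; ring.
have DgE x y : x != 0 -> y != 0 -> det2 (g x) (g y) \in F1.
  move=> /gE x0 /gE y0.
  by have [[? ? _] [? ? _]] := (mem_dirs x0, mem_dirs y0); rewrite rpredB ?rpredM.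
have D1 : z2 * det2 (g z2) (g z) = det2 (g 1) (g z).
  apply: (mulIf ab); transitivity (det2 (h z2) (e (g z))).
    by rewrite /h /e /det2 /lc /sc /=; ring.
  by rewrite -ez2 /h /e /det2 /lc /sc /=; ring.
have D2 : z2 * det2 (g 1) (g z2) = z * det2 (g 1) (g z).
  apply: (mulIf ab); transitivity (det2 (e (g 1)) (h z2)).
    by rewrite /h /e /det2 /lc /sc /=; ring.
  by rewrite -ez2 /h /e /det2 /lc /sc /=; ring.
have D3 : det2 (g 1) (g z) != 0 by rewrite (dirs_det2 (E := F1)) ?gE // eq_sym.
have D4 : det2 (g z2) (g z) != 0.
  by apply: contraNneq D3 => D4; rewrite -D1 D4 mulr0.
have z2E : z2 \in F1.
  have -> : z2 = det2 (g 1) (g z) / det2 (g z2) (g z) by rewrite -D1 mulfK.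
  by rewrite rpred_div ?DgE.
(* As [z2] lies in [F], dividing [h z2] by it stays in [X], so the scalar 1 also has direction
   [g z2]. Then the left side of [D2] vanishes, while its right side does not. *)
have g12 : g 1 = g z2.
  apply: g_dir => //.
  by rewrite -[e _]sc1 scA mul1r -[z2]mul1r -scA memv_sc1 // gX.
have : z * det2 (g 1) (g z) != 0 by rewrite mulf_neq0.
by rewrite -D2 -g12 /det2 [(g 1).2 * _]mulrC subrr mulr0 eqxx.
Qed.

(** * Subspaces closed under inversion are subfields *)

Section InverseClosed.
Variable U : {vspace L}.
Hypotheses (U1 : 1 \in U) (UV : {in U, forall x, x^-1 \in U}).

(** Hua's identity requires [x], [y] and [1 - x * y] to be nonzero; in the degenerate cases the
    product is 0 or [x]. *)
Lemma hua_closed : {in U &, forall x y, x * x * y \in U}.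
Proof.
move=> x y xU yU; have [->|x0] := eqVneq x 0; first by rewrite !mul0r mem0v.
have [->|y0] := eqVneq y 0; first by rewrite mulr0 mem0v.
have [xy|xy] := eqVneq (x * y) 1; first by rewrite -mulrA xy mulr1.
have n0 : 1 - x * y != 0 by rewrite subr_eq0 eq_sym.
have n1 : y^-1 - x = (1 - x * y) / y by rewrite mulrBl mulfK // mul1r.
have n2 : x^-1 + (y^-1 - x)^-1 = (x * (1 - x * y))^-1.
  by rewrite n1; field; rewrite ?x0 ?y0 ?n0.
have -> : x * x * y = x - (x^-1 + (y^-1 - x)^-1)^-1 by rewrite n2 invrK; ring.
by rewrite memvB // UV // memvD ?UV // memvB ?UV.
Qed.

(** Hua closure with [y = 1] gives squares. In characteristic 2, squaring is injective on the finite
    set [U], so [x] is a square of an element of [U] and Hua closure applies; otherwise polarise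
    [(x + y)^2]. *)
Lemma inv_closed_mul : {in U &, forall x y, x * y \in U}.
Proof.
move=> x y xU yU; have sqU z : z \in U -> z * z \in U.
  by move=> zU; rewrite -[z * z]mulr1 hua_closed.
have [c2|c2] := eqVneq (2%:R : F) 0.
  have addLL z : z + z = 0 :> L.
    by rewrite -mulr2n -[z]scale1r -scaler_nat scalerA mulr1 c2 scale0r.
  have sq_uniq : uniq [seq z * z | z <- vseq U].
    rewrite map_inj_uniq ?vseq_uniq // => u v uv; apply/eqP; rewrite -subr_eq0.
    have : (u - v) * (u - v) == 0.
      have -> : (u - v) * (u - v) = (u * u - v * v) - ((u * v + u * v) - (v * v + v * v)).
        by ring.
      by rewrite uv subrr !addLL !subrr.
    by rewrite mulf_eq0 orbb.
  have [||_ eqU] := uniq_min_size sq_uniq (s2 := vseq U).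
  - by move=> w /mapP[z]; rewrite !mem_vseq => zU ->; exact: sqU.
  - by rewrite size_map.
  have : x \in vseq U by rewrite mem_vseq.
  by rewrite -eqU => /mapP[z]; rewrite mem_vseq => zU ->; exact: hua_closed.
have -> : x * y = 2%:R^-1 *: ((x + y) * (x + y) - x * x - y * y).
  have -> : (x + y) * (x + y) - x * x - y * y = (x * y) *+ 2 by ring.
  by rewrite -scaler_nat scalerA mulVf // scale1r.
by rewrite memvZ // !memvB ?sqU // memvD.
Qed.

End InverseClosed.

Lemma inv_closed_subfield (U : {vspace L}) : 1 \in U -> {in U, forall x, x^-1 \in U} ->
  exists E, E = U :> {vspace L}.
Proof.
move=> U1 UV; have UA : is_aspace U.
  by rewrite /is_aspace has_algid1 //; apply/prodvP => x y; exact: inv_closed_mul.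
by exists (ASpace UA).
Qed.

(** A subfield of dimension [d] consists of the roots in [L] of [x^(q^d) = x]. *)
Lemma subfield_dim_inj E E' : \dim E = \dim E' -> E =i E'.
Proof. by move=> d x; rewrite !Fermat's_little_theorem d. Qed.

(** * Sets of members of [D] closed under [F]-sublines *)

(** The regulus condition in coordinates; by [inD_frame] any three distinct members can be brought
    to the form used here. *)
Definition closed_sublines (S : seq {vspace (L * L)%type}) : Prop :=
  forall a b, det2 a b != 0 -> pt a \in S -> pt b \in S -> pt (lc 1 a 1 b) \in S ->
  forall X, subline F1 a b X -> X \in S.

Lemma closed_subline E S : (2 < #|F|)%N -> uniq S -> size S = (#|F| ^ \dim E).+1 ->
  (forall X, X \in S -> inD X) -> closed_sublines S ->
  exists a b, det2 a b != 0 /\ forall X, X \in S <-> subline E a b X.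
Proof.
move=> q2 Su Ssz SD Scl.
have dE : (0 < \dim E)%N by rewrite (leq_trans _ (dimvS (sub1v E))) // dimv1.
have [A [B [C [AS BS CS [AB AC BC]]]]] : exists A B C,
    [/\ A \in S, B \in S, C \in S & [/\ A != B, A != C & B != C]].
  have S3 : (2 < size S)%N.
    rewrite Ssz ltnS (leq_trans (ltnW q2)) // -{1}[#|F|]expn1.
    by rewrite leq_pexp2l // ltnW // ltnW.
  case: S S3 Su {Ssz SD Scl} => [|A [|B [|C S]]] //= _ /and3P[+ + _].
  rewrite !inE !negb_or => /and3P[AB AC _] /andP[BC _].
  by exists A, B, C; rewrite !inE !eqxx ?orbT.
have [a [b [ab eA eB eC]]] := inD_frame (SD _ AS) (SD _ BS) (SD _ CS) AB AC BC.
rewrite {}eA {}eB {}eC {A B C AB AC BC} in AS BS CS.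
(* [T] is the affine part of [S] in the frame where [pt a] is 0, [pt b] is infinity and
   [pt (lc 1 a 1 b)] is 1. *)
pose T : {pred L} := [pred x | pt (lc 1 a x b) \in S].
have lc10 : lc 1 a 0 b = a.
  by rewrite [RHS]surjective_pairing; congr (_, _) => /=; ring.
have lc01 : lc 0 a 1 b = b.
  by rewrite [RHS]surjective_pairing; congr (_, _) => /=; ring.
have T0 : 0 \in T by rewrite inE lc10.
have T1 : 1 \in T by rewrite inE.
(* The [F]-subline through [x], [y] and infinity is the affine [F]-line through [x] and [y]. *)
have Taff x y t : x \in T -> y \in T -> t \in F1 -> x + t * (y - x) \in T.
  move=> xT yT tF; have [->|xy] := eqVneq x y; first by rewrite subrr mulr0 addr0.
  have yx0 : y - x != 0 by rewrite subr_eq0 eq_sym.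
  apply: (Scl (lc 1 a x b) (sc (y - x) b)) => //.
  - by rewrite -[lc 1 a x b]sc1 det2_sc det2_lcl !mulf_neq0 ?oner_neq0.
  - by rewrite pt_sc.
  - move: yT; rewrite inE; congr (pt _ \in S); congr (_, _) => /=; ring.
  exists 1, t; rewrite mem1v tF xpair_eqE oner_eq0; split=> //.
  by congr pt; congr (_, _) => /=; ring.
(* Here [q > 2] enters: it leaves a scalar for which both [m] and [1 + m] are invertible. *)
have [m m0 m1] : exists2 m : F, m != 0 & m != -1.
  have /subsetPn[m _] : ~~ ([set: F] \subset [set 0; -1]).
    apply: contraTN q2 => /subset_leq_card; rewrite cardsT -leqNgt => /leq_trans-> //.
    by rewrite cards2; case: eqP.
  by rewrite !inE negb_or => /andP[]; exists m.
pose M : L := m%:A.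
have MF : M \in F1 by rewrite memvZ ?mem1v.
have M0 : M != 0 by rewrite scaler_eq0 oner_eq0 orbF.
have M1 : 1 + M != 0.
  by rewrite -[X in X + _]scale1r -scalerDl scaler_eq0 oner_eq0 orbF addrC addr_eq0.
have Tscale x t : x \in T -> t \in F1 -> t * x \in T.
  by move=> xT tF; rewrite -[t * x]add0r -[x in t * x]subr0 Taff.
have TD : {in T &, forall x y, x + y \in T}.
  move=> x y xT yT.
  (* The sum is placed on the affine [F]-line through the multiples [x / (1 + M)] and [- y / M],
     which are already in [T]. *)
  have -> : x + y = (1 + M)^-1 * x + - M * ((- M^-1) * y - (1 + M)^-1 * x).
    by field; rewrite M0 M1.
  have MVF : (1 + M)^-1 \in F1 by rewrite (rpredV F1) rpredD ?mem1v.
  have MNF : - M^-1 \in F1 by rewrite rpredN (rpredV F1).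
  by rewrite Taff ?Tscale // rpredN.
have TV x : x \in T -> x^-1 \in T.
  move=> xT; have TF y : y \in F1 -> y \in T by move=> yF; rewrite -[y]mulr1 Tscale.
  have [xF|xF] := boolP (x \in F1); first by rewrite TF // (rpredV F1).
  have x0 : x != 0 by apply: contraNneq xF => ->; rewrite mem0v.
  (* The shift turns the denominator [y + M] below into [x]. *)
  pose y := x - M; have yF : y \notin F1 by rewrite rpredBr.
  have y0 : y != 0 by apply: contraNneq yF => ->; rewrite mem0v.
  have y1 : y - 1 != 0 by rewrite subr_eq0; apply: contraNneq yF => ->; rewrite mem1v.
  have yT : y \in T.
    have -> : y = x + (- M) * 1 by rewrite /y; ring.
    by rewrite TD // Tscale // rpredN.
  (* [(1 + M) y / (y + M)] lies on the [F]-subline through [0], [1] and [y]. *)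
  have zT : (1 + M) * y / x \in T.
    apply: (Scl (sc (y - 1) a) (lc 1 a y b)).
    - by rewrite -[lc 1 a y b]sc1 det2_sc det2_lcr !mulf_neq0 ?oner_neq0.
    - by rewrite pt_sc.
    - by move: yT; rewrite inE.
    - have -> : lc 1 (sc (y - 1) a) 1 (lc 1 a y b) = sc y (lc 1 a 1 b).
        by congr (_, _) => /=; ring.
      by rewrite pt_sc.
    exists 1, (1 + M); rewrite mem1v rpredD ?mem1v // xpair_eqE oner_eq0; split=> //.
    rewrite -(pt_sc _ x0); congr pt; congr (_, _) => /=; rewrite /y; field; exact: x0.
  (* With [y = x - M], the difference [1 + M - (1 + M) y / x] equals [(1 + M) M / x]. *)
  have -> : x^-1 = ((1 + M) * M)^-1 * (1 + M + (- 1) * ((1 + M) * y / x)).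
    by rewrite /y; field; rewrite x0 M0 M1.
  rewrite Tscale ?(rpredV F1) ?rpredM ?rpredD ?mem1v //.
  by apply: TD; [rewrite TF ?rpredD ?mem1v | rewrite Tscale // rpredN mem1v].
have [|U UT] := pred_vspace T0 TD.
  by move=> c x xT; rewrite -mulr_algl Tscale // memvZ ?mem1v.
have [||K KU] := @inv_closed_subfield U; rewrite ?UT //.
  by move=> x; rewrite !UT; exact: TV.
have KT : K =i T by move=> x; rewrite KU UT.
have SK X : (X \in S) = (X \in subline_seq K a b).
  apply/idP/idP => [XS|].
    have [w w0 eX] := inD_pt (SD X XS); rewrite eX in XS *.
    have ew := lc_basis w ab; set s := det2 w b / _ in ew; set t := det2 a w / _ in ew.
    have [s0|s0] := eqVneq s 0.
      have t0 : t != 0 by apply: contraNneq w0 => t0; rewrite ew lc_eq0 // s0 t0.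
      apply/mem_subline_seq; exists 0, 1; rewrite mem0v mem1v xpair_eqE oner_eq0 andbF.
      split=> //; rewrite ew s0 lc01 -(pt_sc b t0); congr pt.
      by congr (_, _) => /=; ring.
    have ew' : pt w = pt (lc 1 a (t / s) b).
      rewrite ew -[in RHS](pt_sc _ s0); congr pt; congr (_, _) => /=; field; exact: s0.
    apply/mem_subline_seq; exists 1, (t / s).
    by rewrite mem1v KT inE -ew' xpair_eqE oner_eq0.
  move=> /mapP[d]; rewrite inE => /predU1P[->|/mapP[t + ->]] -> /=.
    by rewrite lc01.
  by rewrite mem_vseq KT.
(* Both lists are free of repetition, so equal sizes give [K] and [E] the same dimension, hence the
   same elements. *)
have eqsz : size S = size (subline_seq K a b).
  by apply: perm_size; apply: uniq_perm; rewrite // subline_seq_uniq.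
have dKE : \dim E = \dim K.
  move: eqsz; rewrite Ssz size_map size_dirs => -[] /eqP.
  by rewrite eqn_exp2l ?(ltnW q2) // => /eqP.
have KE := subfield_dim_inj dKE.
exists a, b; split=> // X; rewrite SK.
split=> [/mem_subline_seq|] [s [t [sK tK st0 eX]]].
  by exists s, t; rewrite !KE.
by apply/mem_subline_seq; exists s, t; rewrite -!KE.
Qed.

(** One direction uses that the [F]-subline through three members is a regulus, the other that any
    regulus through them lies in that subline. *)
Lemma closed_sublines_reguli S : (forall X, X \in S -> inD X) ->
  (forall A B C, A \in S -> B \in S -> C \in S -> A != B -> A != C -> B != C ->
    forall R, regulus R -> A \in R -> B \in R -> C \in R ->
    forall X, X \in R -> X \in S) <-> closed_sublines S.
Proof.
move=> SD; split=> [Sreg a b ab aS bS cS X abX | Scl A B C AS BS CS AB AC BC R Rreg].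
  have sub s t : s \in F1 -> t \in F1 -> (s, t) != (0, 0) ->
      pt (lc s a t b) \in subline_seq F1 a b.
    by move=> sF tF st0; apply/mem_subline_seq; exists s, t.
  apply: (Sreg _ _ _ aS bS cS _ _ _ _ (subline_regulus ab)).
  - exact: det2_pt_neq.
  - by rewrite det2_pt_neq // det2_lcr mul1r.
  - by rewrite eq_sym det2_pt_neq // det2_lcl mul1r.
  - have {1}-> : a = lc 1 a 0 b by rewrite [LHS]surjective_pairing; congr (_, _) => /=; ring.
    by rewrite sub ?mem0v ?mem1v // xpair_eqE oner_eq0.
  - have {1}-> : b = lc 0 a 1 b.
      by rewrite [LHS]surjective_pairing; congr (_, _) => /=; ring.
    by rewrite sub ?mem0v ?mem1v // xpair_eqE oner_eq0 andbF.
  - by rewrite sub ?mem1v // xpair_eqE oner_eq0.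
  exact/mem_subline_seq.
have [a [b [ab eA eB eC]]] := inD_frame (SD _ AS) (SD _ BS) (SD _ CS) AB AC BC.
rewrite {}eA {}eB {}eC {A B C AB AC BC} in AS BS CS * => aR bR cR X XR.
exact: (Scl a b ab) (regulus_subline Rreg ab aR bR cR XR).
Qed.

(** * Subspaces meeting every member of [S] in dimension [k] *)

(** Distinct members of [D] meet only in 0, so the intersections contribute
    [(q^k + 1)(q^k - 1) = q^(2k) - 1] distinct nonzero vectors, which are all those of [W]. *)
Lemma capv_cover S W (k : nat) : uniq S -> size S = (#|F| ^ k).+1 ->
  (forall X, X \in S -> inD X) -> \dim W = (2 * k)%N ->
  (forall X, X \in S -> \dim (W :&: X) = k) ->
  forall w, w \in W -> w != 0 -> pt w \in S.
Proof.
move=> Su Ssz SD dW dWX w wW w0.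
pose nz V := rem 0 (vseq V).
have mem_nz V v : (v \in nz V) = (v != 0) && (v \in V).
  by rewrite mem_rem_uniq ?vseq_uniq // !inE mem_vseq.
have size_nz V : size (nz V) = (#|F| ^ \dim V).-1.
  by rewrite size_rem ?size_vseq // mem_vseq mem0v.
pose s := [seq v | X <- S, v <- nz (W :&: X)%VS].
have mem_s v : v \in s -> [/\ v != 0, v \in W & pt v \in S].
  case/allpairsPdep => X [u [XS + ->]].
  rewrite mem_nz memv_cap => /and3P[v0 vW vX].
  by rewrite -(inD_mem (SD X XS) vX v0).
have s_uniq : uniq s.
  apply: allpairs_uniq_dep => // [X _|]; first by rewrite rem_uniq ?vseq_uniq.
  move=> p p' /allpairsPdep[X [v [XS + ->]]] /allpairsPdep[Y [u [YS + ->]]] /=.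
  rewrite !mem_nz !memv_cap => /and3P[v0 _ vX] /and3P[_ _ uY] e.
  rewrite -e in uY *.
  by rewrite (inD_mem (SD X XS) vX v0) (inD_mem (SD Y YS) uY v0).
have size_s : (size (nz W) <= size s)%N.
  rewrite size_allpairs_dep size_nz dW.
  have -> : [seq size (nz (W :&: X)%VS) | X <- S] = nseq (size S) (#|F| ^ k).-1.
    by elim: S {Su Ssz SD mem_s s_uniq s} dWX => //= X S IH dWX;
      rewrite size_nz dWX ?mem_head // IH // => Y YS; rewrite dWX // inE YS orbT.
  by rewrite sumn_nseq Ssz mul2n -addnn expnD; case: (#|F| ^ k)%N => // m; lia.
have [|_ eq_s] := uniq_min_size s_uniq (s2 := nz W) _ size_s.
  by move=> v /mem_s[v0 vW _]; rewrite mem_nz v0.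
have : w \in nz W by rewrite mem_nz w0.
by rewrite -eq_s => /mem_s[].
Qed.

Lemma capv_closed S W (k : nat) : (0 < k)%N -> uniq S -> size S = (#|F| ^ k).+1 ->
  (forall X, X \in S -> inD X) -> \dim W = (2 * k)%N ->
  (forall X, X \in S -> \dim (W :&: X) = k) -> closed_sublines S.
Proof.
move=> k0 Su Ssz SD dW dWX a b ab aS bS cS _ [s [t [s1 t1 st0 ->]]].
have Wcover := capv_cover Su Ssz SD dW dWX.
(* The two intersections are disjoint of dimension [k], so they fill [W]. *)
have Wab : W = ((W :&: pt a) + (W :&: pt b))%VS.
  apply/esym/eqP; rewrite eqEdim subv_add !capvSl /= dimv_disjoint_sum.
    by rewrite !dWX // dW mul2n addnn.
  apply/eqP; rewrite -subv0; apply/subvP => v.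
  rewrite !memv_cap memv0 => /andP[/andP[_ va] /andP[_ vb]].
  apply: contraNT (det2_pt_neq ab) => v0.
  by rewrite -(pt_mem va v0) -(pt_mem vb v0).
(* A nonzero vector [z (a + b)] of [W] splits along [Wab] into [z a] and [z b], so [W] contains the
   [F]-line [z <a, b>_F]; [capv_cover] puts its points in [S]. *)
have /capv_neq0P[c [c0 cW /mem_pt[z ec]]] : (W :&: pt (lc 1 a 1 b) != 0)%VS.
  by rewrite -dimv_eq0 dWX // -lt0n.
have z0 : z != 0 by move: c0; rewrite ec sc_eq0 => /norP[].
move: (cW); rewrite {1}Wab => /memv_addP[u uWa [v vWb cuv]].
move: uWa vWb; rewrite !memv_cap => /andP[uW /mem_pt[x eu]] /andP[vW /mem_pt[y ev]].
have ecxy : sc z (lc 1 a 1 b) = lc x a y b.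
  by rewrite -ec cuv eu ev; congr (_, _) => /=; ring.
have ex : x = z.
  apply: (mulIf ab); by rewrite -(det2_lcl x a y) -ecxy /det2 /=; ring.
have ey : y = z.
  apply: (mulIf ab); by rewrite -(det2_lcr x a y) -ecxy /det2 /=; ring.
rewrite -(pt_sc _ z0); apply: Wcover; last by rewrite sc_eq0 negb_or z0 lc_eq0.
have -> : sc z (lc s a t b) = lc s u t v.
  by rewrite eu ev ex ey; congr (_, _) => /=; ring.
exact: lc_mem.
Qed.

(** [W] is the [E]-span of [a] and [b]. A multiple of [s a + t b] by [x] lies in it only if [x s]
    and [x t] lie in [E]; one of [s], [t] is nonzero, so [x] is in [E]. *)
Lemma subline_capv E S a b : det2 a b != 0 ->
  (forall X, X \in S -> subline E a b X) ->
  exists W, \dim W = (2 * \dim E)%N /\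
    forall X, X \in S -> \dim (W :&: X) = \dim E /\ inDk E (W :&: X).
Proof.
move=> ab SE; have [a0 b0] := det2_neq0 ab.
pose W := (spr E a.1 a.2 + spr E b.1 b.2)%VS.
have memW w : reflect (exists s t, [/\ s \in E, t \in E & w = lc s a t b]) (w \in W).
  have lcE s t : lc s a t b = sc s a + sc t b by congr (_, _) => /=; ring.
  apply: (iffP memv_addP) => [[_ /mem_spr[s sE ->] [_ /mem_spr[t tE ->] ->]]|].
    by exists s, t; rewrite lcE.
  case=> s [t [sE tE ->]]; exists (sc s a); first by apply/mem_spr; exists s.
  by exists (sc t b); [apply/mem_spr; exists t | rewrite lcE].
exists W; split.
  rewrite dimv_disjoint_sum ?dim_spr //; first by rewrite mul2n addnn.
  apply/eqP; rewrite -subv0; apply/subvP => v.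
  rewrite memv_cap memv0 => /andP[/mem_spr[s _ ->] /mem_spr[t _ e]].
  rewrite sc_eq0 (negPf a0) orbF -(mulIr_eq0 s (mulIf ab)).
  have : det2 (sc s a) b = 0 by rewrite e /det2 /=; ring.
  by rewrite -{1}[b]sc1 det2_sc mulr1 => ->.
move=> X /SE[s [t [sE tE st0 ->]]].
have w0 : lc s a t b != 0 by rewrite lc_eq0.
have -> : (W :&: pt (lc s a t b))%VS = spr E (lc s a t b).1 (lc s a t b).2.
  apply/vspaceP => v; rewrite memv_cap.
  apply/andP/mem_spr => [[/memW[s' [t' [s'E t'E ->]]] /mem_pt[x ex]]|[x xE ->]].
    exists x => //; have ex0 : lc (s' - x * s) a (t' - x * t) b = 0.
      transitivity (lc s' a t' b - sc x (lc s a t b)); last by rewrite ex subrr.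
      by congr (_, _) => /=; ring.
    move/eqP: ex0; rewrite lc_eq0 // xpair_eqE !subr_eq0 => /andP[/eqP es /eqP et].
    have [s0|s0] := eqVneq s 0; last by rewrite -(mulfK s0 x) -es rpred_div.
    have t0 : t != 0 by apply: contraNneq st0 => ->; rewrite s0.
    by rewrite -(mulfK t0 x) -et rpred_div.
  split; last by apply/mem_pt; exists x.
  by apply/memW; exists (x * s), (x * t); rewrite !rpredM // lc_sc.
split; first exact: dim_spr.
by exists (lc s a t b).1, (lc s a t b).2; rewrite -surjective_pairing.
Qed.

(** * From sublines of the line at infinity in PG(2, L) to pairs in [L * L] *)

Lemma phi_sublineP E S :
  is_phi_of_subline_in_linf E S <->
  exists a b, det2 a b != 0 /\ forall X, X \in S <-> subline E a b X.
Proof.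
pose pr (u : 'rV[L]_3) : (L * L)%type := (u 0 0, u 0 1).
have phiE (u v : 'rV[L]_3) s t : phi (s *: u + t *: v) = pt (lc s (pr u) t (pr v)).
  by rewrite /phi !mxE.
split=> [[u [v [uv uv2 SE]]]|[a [b [ab SE]]]].
  have u2 : u 0 2 = 0.
    have := uv2 1 0 (mem1v E) (mem0v E); rewrite scale1r scale0r addr0.
    by apply; rewrite xpair_eqE oner_eq0.
  have v2 : v 0 2 = 0.
    have := uv2 0 1 (mem0v E) (mem1v E); rewrite scale1r scale0r add0r.
    by apply; rewrite xpair_eqE oner_eq0 andbF.
  exists (pr u), (pr v); split.
    have row0 (w : 'rV[L]_3) : w 0 2 = 0 -> pr w = (0, 0) -> w = 0.
      move=> w2 [w0 w1]; apply/rowP => i; rewrite mxE.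
      by case: i => -[|[|[|//]]] lt_i; [rewrite -w0|rewrite -w1|rewrite -w2];
        congr (w _ _); apply: val_inj.
    (* If the determinant vanishes, so do [v_0 u - u_0 v] and [v_1 u - u_1 v]; independence then
       gives [u_0 = u_1 = 0], hence [u = 0], a contradiction. *)
    apply/negP => /eqP d.
    have r1 : pr (v 0 0 *: u - u 0 0 *: v) = (0, 0).
      rewrite /pr !mxE; congr (_, _); first by ring.
      transitivity (- det2 (pr u) (pr v)); last by rewrite d oppr0.
      by rewrite /det2 /=; ring.
    have r2 : pr (v 0 1 *: u - u 0 1 *: v) = (0, 0).
      rewrite /pr !mxE; congr (_, _); last by ring.
      by rewrite -d /det2 /=; ring.
    have /row0/(_ r1) : (v 0 0 *: u - u 0 0 *: v) 0 2 = 0.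
      by rewrite !mxE u2 v2 !mulr0 subr0.
    rewrite -scaleNr => /uv[_ /eqP]; rewrite oppr_eq0 => /eqP u0.
    have /row0/(_ r2) : (v 0 1 *: u - u 0 1 *: v) 0 2 = 0.
      by rewrite !mxE u2 v2 !mulr0 subr0.
    rewrite -scaleNr => /uv[_ /eqP]; rewrite oppr_eq0 => /eqP u1.
    have uz : u = 0 by apply: row0; rewrite // /pr u0 u1.
    have [] := uv 1 0; first by rewrite uz scaler0 scale0r addr0.
    by move=> /eqP; rewrite oner_eq0.
  move=> X; rewrite SE; split=> -[s [t [sE tE st0 ->]]]; exists s, t; split=> //.
pose row (w : (L * L)%type) : 'rV[L]_3 := \row_j [:: w.1; w.2; 0]`_j.
have prK w : pr (row w) = w by rewrite /pr !mxE -surjective_pairing.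
exists (row a), (row b); split.
- move=> s t /rowP st; have : lc s a t b == 0.
    apply/eqP; have := st 0; have := st 1; rewrite !mxE /= => e1 e0.
    by rewrite /lc e0 e1.
  by rewrite lc_eq0 // xpair_eqE => /andP[/eqP -> /eqP ->].
- by move=> s t _ _ _; rewrite !mxE /= !mulr0 addr0.
move=> X; rewrite SE; split=> -[s [t [sE tE st0 ->]]]; exists s, t; split=> //.
  by rewrite phiE !prK.
by rewrite phiE !prK.
Qed.

End Points.

(** * The four conditions, linked through closure under [F]-sublines *)

Theorem theorem2p10 (F : finFieldType) (L : fieldExtType F)
    (K : {subfield L}) (q n k : nat)
    (Hq : #|F| = q) (Hq2 : (2 < q)%N) (Hn : \dim {:L} = n) (Hn1 : (1 <= n)%N)
    (Hk : \dim K = k) (Hkn : (k %| n)%N)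
    (S : seq {vspace (L * L)%type})
    (HSu : uniq S) (HSsz : size S = (q ^ k).+1)
    (HSD : forall X, X \in S -> inD X) :
  [/\ (* (1) <-> (2) *)
      is_phi_of_subline_in_linf K S <->
       (forall A B C, A \in S -> B \in S -> C \in S ->
          A != B -> A != C -> B != C ->
          forall R, regulus R -> A \in R -> B \in R -> C \in R ->
          forall X, X \in R -> X \in S),
      (* (1) <-> (3) *)
      is_phi_of_subline_in_linf K S <->
       (exists W : {vspace (L * L)%type}, \dim W = (2 * k)%N /\
          forall X, X \in S -> \dim (W :&: X)%VS = k) &
      (* (1) <-> (4) *)
      is_phi_of_subline_in_linf K S <->
       (exists W : {vspace (L * L)%type}, \dim W = (2 * k)%N /\
          forall X, X \in S -> \dim (W :&: X)%VS = k /\ inDk K (W :&: X)%VS)].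
Proof.
subst q k.
have k0 : (0 < \dim K)%N by rewrite (leq_trans _ (dimvS (sub1v K))) // dimv1.
(* The cycle runs from (1) to (4) to (3) to closure under [F]-sublines and back to (1); closure is
   equivalent to (2). *)
have c2_1 : closed_sublines S -> is_phi_of_subline_in_linf K S.
  by move=> Scl; apply/phi_sublineP; apply: closed_subline.
have c3_2 : (exists W : {vspace (L * L)%type}, \dim W = (2 * \dim K)%N /\
    forall X, X \in S -> \dim (W :&: X)%VS = \dim K) -> closed_sublines S.
  by case=> W [dW dWX]; apply: capv_closed HSsz HSD dW dWX.
have c1_4 : is_phi_of_subline_in_linf K S ->
    exists W : {vspace (L * L)%type}, \dim W = (2 * \dim K)%N /\
    forall X, X \in S -> \dim (W :&: X)%VS = \dim K /\ inDk K (W :&: X)%VS.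
  move=> /phi_sublineP[a [b [ab SK]]].
  by apply: subline_capv ab _ => X; rewrite SK.
have c4_3 : (exists W : {vspace (L * L)%type}, \dim W = (2 * \dim K)%N /\
      forall X, X \in S -> \dim (W :&: X)%VS = \dim K /\ inDk K (W :&: X)%VS) ->
    exists W : {vspace (L * L)%type}, \dim W = (2 * \dim K)%N /\
      forall X, X \in S -> \dim (W :&: X)%VS = \dim K.
  by case=> W [dW WS]; exists W; split=> // X /WS[].
have c12 := closed_sublines_reguli HSD.
by split; rewrite -?c12; tauto.
Qed.
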